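(* There exists a regainingly approximable set $A\subseteq\mathbb{N}$ that is Kummer $K$-complex, i.e., there is a constant $d\in\mathbb{N}$ such that $K(A\restriction n)\ge 2\log(n)+\log\log(n)-d$ for infinitely many $n$.
   Context: A real number $\alpha$ is regainingly approximable if there exists a computable nondecreasing sequence of rational numbers $(a_n)_n$ converging to $\alpha$ such that $\alpha-a_n<2^{-n}$ holds for infinitely many $n\in\mathbb{N}$. For $A\subseteq\mathbb{N}$ let $2^{-A}:=\sum_{a\in A}2^{-(a+1)}$; a set $A\subseteq\mathbb{N}$ is regainingly approximable if it is computably enumerable and $2^{-A}$ is regainingly approximable. $K$ denotes prefix-free Kolmogorov complexity; $A\restriction n$ is the string $A(0)\dots A(n-1)$ of the characteristic sequence of $A$. For $n\in\mathbb{N}$, $\log(n)$ denotes the length of the binary representation of $n$ (so $\log(n)=\lfloor\log_2 n\rfloor+1$ for $n>0$ and $\log(0)=1$). *)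

(* Defs.v *)
From HB Require Import structures.
From mathcomp Require Import all_boot all_order all_algebra.
From mathcomp Require Import all_classical all_reals all_analysis.
Import Order.TTheory GRing.Theory Num.Theory.
Import numFieldNormedType.Exports.

Set Implicit Arguments.
Unset Strict Implicit.
Unset Printing Implicit Defensive.

Local Open Scope classical_set_scope.
Local Open Scope ring_scope.

(* [recfn n] is the syntax of the n-ary partial recursive functions. *)
Inductive recfn : nat -> Type :=
| RZero : recfn 0
| RSucc : recfn 1
| RProj n (i : 'I_n) : recfn n
| RComp m n (f : recfn m) (g : 'I_m -> recfn n) : recfn n
| RPrim n (f : recfn n) (g : recfn n.+2) : recfn n.+1
| RMin n (f : recfn n.+1) : recfn n.

(* Graph of primitive recursion: [base] is the graph of h(0), [step k z] is
   the graph of h(k+1) when h(k) = z. *)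
Fixpoint prim_rec_graph (base : nat -> Prop) (step : nat -> nat -> nat -> Prop)
    (k : nat) : nat -> Prop :=
  match k with
  | 0%N => base
  | k'.+1 => fun y => exists2 z, prim_rec_graph base step k' z & step k' z y
  end.

(* [rec_eval f v y]: the partial function denoted by f is defined at v, with
   value y. The recursion variable of RPrim and the search variable of RMin
   come first; in RPrim, g takes (k, h(k), parameters). *)
Fixpoint rec_eval n (f : recfn n) : n.-tuple nat -> nat -> Prop :=
  match f in recfn n return n.-tuple nat -> nat -> Prop with
  | RZero => fun _ y => y = 0%N
  | RSucc => fun v y => y = (thead v).+1
  | RProj _ i => fun v y => y = tnth v i
  | RComp m _ f g => fun v y =>
      exists w : m.-tuple nat,
        (forall i, rec_eval (g i) v (tnth w i)) /\ rec_eval f w y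
  | RPrim _ f g => fun v y =>
      let u := behead_tuple v in
      prim_rec_graph (rec_eval f u)
        (fun k z => rec_eval g (cons_tuple k (cons_tuple z u))) (thead v) y
  | RMin _ f => fun v y =>
      rec_eval f (cons_tuple y v) 0 /\
      (forall k, (k < y)%N -> exists z, rec_eval f (cons_tuple k v) z.+1)
  end.

Definition computable (h : nat -> nat) : Prop :=
  exists f : recfn 1, forall n, rec_eval f [tuple n] (h n).

Definition computably_enumerable (A : set nat) : Prop :=
  exists f : recfn 1, forall n, A n <-> exists y, rec_eval f [tuple n] y.

Definition computable_rat_seq (a : nat -> rat) : Prop :=
  exists s p q : nat -> nat,
    [/\ computable s, computable p, computable q
      & forall n, q n <> 0%N /\ a n = (-1) ^+ s n * ((p n)%:R / (q n)%:R)].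

Definition regainingly_approximable_real (R : realType) (alpha : R) : Prop :=
  exists a : nat -> rat,
    [/\ computable_rat_seq a,
        (forall n, a n <= a n.+1),
        (ratr (a n) : R) @[n --> \oo] --> alpha
      & infinite_set [set n | alpha - ratr (a n) < 2 ^- n]].

(* The partial sums are nondecreasing and at most 1, so the limit exists. *)
Definition two_pow_opp (R : realType) (A : set nat) : R :=
  limn (fun n => \sum_(0 <= a < n | a \in A) (2 : R) ^- a.+1).

Definition regainingly_approximable_set (R : realType) (A : set nat) : Prop :=
  computably_enumerable A /\ regainingly_approximable_real (two_pow_opp R A).

(* The number whose binary expansion is 1 followed by s (most significant bit
   first). This identifies binary strings with the positive integers. *)
Definition code_str (s : bitseq) : nat :=
  foldl (fun (m : nat) (b : bool) => (m.*2 + b)%N) 1%N s.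

(* A unary program, seen as a machine on binary strings. The value 0 encodes
   no string: the machine is undefined on p when f(code_str p) = 0. *)
Definition run (f : recfn 1) (p x : bitseq) : Prop :=
  rec_eval f [tuple code_str p] (code_str x).

Definition prefix_free_machine (f : recfn 1) : Prop :=
  forall p q x y, run f p x -> run f q y -> prefix p q -> p = q.

Definition optimal_prefix_free_machine (U : recfn 1) : Prop :=
  prefix_free_machine U /\
  forall M, prefix_free_machine M ->
    exists c : nat, forall p x, run M p x ->
      exists2 q, run U q x & (size q <= size p + c)%N.

(* Length of a shortest U-program for x. The default value 0 of [xget] is only
   taken when x has no U-program, which is impossible for optimal U. *)
Definition K_complexity (U : recfn 1) (x : bitseq) : nat :=
  xget 0%N [set k | (exists2 p, run U p x & size p = k) /\
                    (forall p, run U p x -> (k <= size p)%N)].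

Definition restriction (A : set nat) (n : nat) : bitseq :=
  mkseq (fun i => i \in A) n.

(* Length of the binary representation of n; trunc_log 2 0 = 0, so the value
   at 0 is 1. *)
Definition binlog (n : nat) : nat := (trunc_log 2 n).+1.

(* K is determined by the choice of an optimal prefix-free machine U only up
   to an additive constant, which d absorbs: the condition below does not
   depend on U. *)
Definition Kummer_K_complex (A : set nat) : Prop :=
  forall U, optimal_prefix_free_machine U ->
    exists d : nat, infinite_set
      [set n | (2 * binlog n + binlog (binlog n) - d
                  <= K_complexity U (restriction A n))%N].

(* Main.v *)
Require Import Defs.
From mathcomp Require Import all_boot all_order all_algebra.
From mathcomp Require Import all_classical all_reals all_analysis.
From mathcomp Require Import zify ring lra.
Set Implicit Arguments.
Unset Strict Implicit.
Unset Printing Implicit Defensive.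
Import Order.TTheory GRing.Theory Num.Theory.
Import numFieldNormedType.Exports.

(* Fix an optimal machine U (others change K by a bounded amount only).
   Cut the naturals into the blocks B_j = [2^2^j, 2^2^(j+1)[. At stage s, if for
   some j < s every A_s|n with n in B_j already has a short U-program, put the
   largest missing element x of B_j into A (for the least such j), and dump the
   whole interval [x, 2^2^(s+1)[ along with it. Because of the dumping there are
   infinitely many stages s after which A no longer changes below 2^2^s, which
   makes A regainingly approximable. The block B_s of such a stage is never
   disturbed from below. If all A|n with n in B_s had short programs, B_s would
   be filled from the top down, one element at a time, and every string
   (A_s U ]x, oo[)|n with x < n in B_s would have a short program; since
   sum_(n in B_s) #{x < n in B_s} / n^2 is of order 2^s, this contradicts
   Kraft's inequality. *)

(** * Total recursive functions *)

(** Lists instead of tuples let arguments be added and dropped without casts; only the values of [F]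
    on lists of length [n] matter. A boolean [F] is read as a 0-1 function through the coercion to
    [nat]. *)
Definition total_rec n (F : seq nat -> nat) : Prop :=
  exists f : recfn n, forall v : n.-tuple nat, rec_eval f v (F v).

Lemma total_rec_ext n F G :
  (forall v, size v = n -> F v = G v) -> total_rec n F -> total_rec n G.
Proof. by move=> FG [f fP]; exists f => v; rewrite -FG ?size_tuple. Qed.

Lemma total_rec_comp m n F (G : 'I_m -> seq nat -> nat) :
  total_rec m F -> (forall i, total_rec n (G i)) ->
  total_rec n (fun v => F [seq G i v | i <- enum 'I_m]).
Proof.
move=> [f fP] /choice[g gP]; exists (RComp f g) => v /=.
exists [tuple G i v | i < m]; split; last exact: fP.
by move=> i; rewrite tnth_mktuple.
Qed.

Lemma total_rec_zero n : total_rec n (fun=> 0).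
Proof.
have zP : total_rec 0 (fun=> 0) by exists RZero.
by apply: (total_rec_comp (G := fun _ _ => 0) zP) => -[].
Qed.

Lemma total_rec_nth n i : total_rec n (nth 0 ^~ i).
Proof.
have [ni|ni] := leqP n i.
  by apply: total_rec_ext (total_rec_zero n) => v sv; rewrite nth_default ?sv.
by exists (RProj (Ordinal ni)) => v; rewrite /= (tnth_nth 0).
Qed.

Lemma total_rec_cut n H K :
  total_rec n.+1 H -> total_rec n K -> total_rec n (fun v => H (K v :: v)).
Proof.
move=> Hr Kr.
pose G (i : 'I_n.+1) v := if val i is k.+1 then nth 0 v k else K v.
have Gr i : total_rec n (G i).
  by rewrite /G; case: (val i) => [|k] //; apply: total_rec_nth.
apply: total_rec_ext (total_rec_comp Hr Gr) => v sv; congr H.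
apply: (@eq_from_nth _ 0); first by rewrite size_map size_enum_ord /= sv.
rewrite size_map size_enum_ord => i iltn.
by rewrite (nth_map ord0) ?size_enum_ord // /G [val _]nth_enum_ord //; case: i {iltn}.
Qed.

Lemma total_rec_behead n F :
  total_rec n F -> total_rec n.+1 (fun w => F (behead w)).
Proof.
move=> Fr.
have Gr (i : 'I_n) : total_rec n.+1 (fun w => nth 0 w i.+1).
  exact: total_rec_nth.
apply: total_rec_ext (total_rec_comp Fr Gr) => v sv; congr F.
apply: (@eq_from_nth _ 0); first by rewrite size_map size_enum_ord size_behead sv.
rewrite size_map size_enum_ord => i iltn.
rewrite (nth_map (Ordinal iltn)) ?size_enum_ord // nth_enum_ord //.
by rewrite nth_behead.
Qed.

Lemma total_rec_behead2 n F :
  total_rec n F -> total_rec n.+2 (fun w => F (behead (behead w))).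
Proof.
by move=> Fr; apply: (total_rec_behead (F := F \o behead)); exact: total_rec_behead.
Qed.

(** In the step of a primitive recursion the second argument is the previous value; here it is
    ignored. *)
Lemma total_rec_skip n F :
  total_rec n.+1 F ->
  total_rec n.+2 (fun w => F (head 0 w :: behead (behead w))).
Proof.
move=> Fr.
pose G (i : 'I_n.+1) w := if val i is k.+1 then nth 0 w k.+2 else nth 0 w 0.
have Gr i : total_rec n.+2 (G i).
  by rewrite /G; case: (val i) => [|k]; apply: total_rec_nth.
apply: total_rec_ext (total_rec_comp Fr Gr) => -[|x [|y v]] //= [sv].
congr F; apply: (@eq_from_nth _ 0); first by rewrite size_map size_enum_ord /= sv.
rewrite size_map size_enum_ord => i iltn.
rewrite (nth_map ord0) ?size_enum_ord // /G [val _]nth_enum_ord //.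
by case: i {iltn}.
Qed.

Lemma total_rec_head n : total_rec n (head 0).
Proof. by apply: total_rec_ext (total_rec_nth n 0) => v _; rewrite nth0. Qed.

Lemma total_rec_head2 n : total_rec n.+1 (fun w => head 0 (behead w)).
Proof. exact: total_rec_behead (total_rec_head n). Qed.

Lemma total_rec_succ n F : total_rec n F -> total_rec n (fun v => (F v).+1).
Proof.
move=> Fr; have sP : total_rec 1 (fun v => (nth 0 v 0).+1).
  by exists RSucc => v /=; rewrite nth0; case/tupleP: v => x v.
apply: total_rec_ext (total_rec_comp sP (G := fun _ => F) _) => // v _.
by rewrite (nth_map ord0) ?size_enum_ord.
Qed.

Lemma total_rec_prim n F G K :
  total_rec n F ->
  total_rec n.+2
    (fun w => G (head 0 w) (head 0 (behead w)) (behead (behead w))) ->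
  total_rec n K ->
  total_rec n
    (fun v => nat_rect (fun=> nat) (F v) (fun k z => G k z v) (K v)).
Proof.
move=> [f fP] [g gP] Kr.
pose H w := nat_rect (fun=> nat) (F (behead w))
                     (fun k z => G k z (behead w)) (head 0 w).
apply: (total_rec_cut (H := H)) => //; exists (RPrim f g).
case/tupleP=> x v; rewrite /= /H /= theadE.
have -> : behead_tuple (cons_tuple x v) = v by apply: val_inj.
elim: x => [|x IH] /=; first exact: fP.
by eexists; [exact: IH | apply: gP].
Qed.

Lemma total_rec_cst n k : total_rec n (fun=> k).
Proof. by elim: k => [|k]; [exact: total_rec_zero | exact: total_rec_succ]. Qed.

Ltac total_rec_leaf :=
  lazymatch goal with
  | H : total_rec ?n ?F |- total_rec ?n ?F => exact: H
  | |- total_rec _ (fun _ => ?k) => exact: total_rec_cst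
  | |- total_rec _ (head 0) => exact: total_rec_head
  | |- total_rec _ (fun w => head 0 w) => exact: total_rec_head
  | |- total_rec _ (fun w => head 0 (behead w)) => exact: total_rec_head2
  | H : total_rec ?n ?F |- total_rec ?n (fun w => ?F w) => exact: H
  | H : total_rec ?n ?F |- total_rec _ (fun w => ?F (behead w)) =>
      exact: total_rec_behead H
  | H : total_rec ?n ?F |- total_rec _ (fun w => ?F (behead (behead w))) =>
      exact: total_rec_behead2 H
  end.

(** * Arithmetic, Boolean connectives and bounded search *)

Lemma total_rec_add n F G :
  total_rec n F -> total_rec n G -> total_rec n (fun v => F v + G v).
Proof.
move=> Fr Gr.
apply: total_rec_ext (total_rec_prim (G := fun _ z _ => z.+1) Fr _ Gr).
  by move=> v _; elim: (G v) => [|k /= ->]; rewrite ?addn0 ?addnS.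
by apply: total_rec_succ; total_rec_leaf.
Qed.

Lemma total_rec_pred n F : total_rec n F -> total_rec n (fun v => (F v).-1).
Proof.
move=> Fr.
apply: total_rec_ext
  (total_rec_prim (G := fun k _ _ => k) (total_rec_zero n) _ Fr).
  by move=> v _; case: (F v).
by total_rec_leaf.
Qed.

Lemma total_rec_sub n F G :
  total_rec n F -> total_rec n G -> total_rec n (fun v => F v - G v).
Proof.
move=> Fr Gr.
apply: total_rec_ext (total_rec_prim (G := fun _ z _ => z.-1) Fr _ Gr).
  by move=> v _; elim: (G v) => [|k /= ->]; rewrite ?subn0 ?subnS.
by apply: total_rec_pred; total_rec_leaf.
Qed.

Lemma total_rec_mul n F G :
  total_rec n F -> total_rec n G -> total_rec n (fun v => F v * G v).
Proof.
move=> Fr Gr.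
apply: total_rec_ext
  (total_rec_prim (G := fun _ z v => F v + z) (total_rec_zero n) _ Gr).
  by move=> v _; elim: (G v) => [|k /= ->]; rewrite ?muln0 ?mulnS.
by apply: total_rec_add; total_rec_leaf.
Qed.

Lemma total_rec_exp n F G :
  total_rec n F -> total_rec n G -> total_rec n (fun v => F v ^ G v).
Proof.
move=> Fr Gr.
apply: total_rec_ext
  (total_rec_prim (G := fun _ z v => F v * z) (total_rec_cst n 1) _ Gr).
  by move=> v _; elim: (G v) => [|k /= ->]; rewrite ?expn0 ?expnS.
by apply: total_rec_mul; total_rec_leaf.
Qed.

Lemma total_rec_leq n F G :
  total_rec n F -> total_rec n G -> total_rec n (fun v => F v <= G v).
Proof.
move=> Fr Gr; apply: total_rec_ext (total_rec_sub (total_rec_cst n 1)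
  (total_rec_sub Fr Gr)) => v _.
by rewrite -subn_eq0; case: (F v - G v).
Qed.

Lemma total_rec_neg n (P : seq nat -> bool) :
  total_rec n P -> total_rec n (fun v => ~~ P v).
Proof.
move=> Pr; apply: total_rec_ext (total_rec_sub (total_rec_cst n 1) Pr) => v _.
by case: (P v).
Qed.

Lemma total_rec_and n (P Q : seq nat -> bool) :
  total_rec n P -> total_rec n Q -> total_rec n (fun v => P v && Q v).
Proof.
by move=> Pr Qr; apply: total_rec_ext (total_rec_mul Pr Qr) => v _; rewrite mulnb.
Qed.

Lemma total_rec_imp n (P Q : seq nat -> bool) :
  total_rec n P -> total_rec n Q -> total_rec n (fun v => P v ==> Q v).
Proof.
move=> Pr /total_rec_neg Qr.
apply: total_rec_ext (total_rec_neg (total_rec_and Pr Qr)) => v _.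
by case: (P v); case: (Q v).
Qed.

Lemma total_rec_eq n F G :
  total_rec n F -> total_rec n G -> total_rec n (fun v => F v == G v).
Proof.
move=> Fr Gr; apply: total_rec_ext (total_rec_and (total_rec_leq Fr Gr)
  (total_rec_leq Gr Fr)) => v _.
by rewrite eqn_leq.
Qed.

Lemma total_rec_if n (P : seq nat -> bool) F G :
  total_rec n P -> total_rec n F -> total_rec n G ->
  total_rec n (fun v => if P v then F v else G v).
Proof.
move=> Pr Fr Gr; apply: total_rec_ext (total_rec_add (total_rec_mul Pr Fr)
  (total_rec_mul (total_rec_neg Pr) Gr)) => v _.
by case: (P v); rewrite /= !mul1n ?addn0.
Qed.

Lemma total_rec_count n (P : nat -> seq nat -> bool) K :
  total_rec n.+1 (fun w => P (head 0 w) (behead w)) -> total_rec n K ->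
  total_rec n (fun v => count (P ^~ v) (iota 0 (K v))).
Proof.
move=> Pr Kr; apply: total_rec_ext
  (total_rec_prim (G := fun k z v => z + P k v) (total_rec_zero n) _ Kr).
  move=> v _; elim: (K v) => // k IH.
  by rewrite -[in RHS]addn1 iotaD count_cat -IH /= addn0.
apply: total_rec_add; first by total_rec_leaf.
exact: (total_rec_skip Pr).
Qed.

Lemma total_rec_all n (P : nat -> seq nat -> bool) K :
  total_rec n.+1 (fun w => P (head 0 w) (behead w)) -> total_rec n K ->
  total_rec n (fun v => all (P ^~ v) (iota 0 (K v))).
Proof.
move=> Pr Kr; apply: total_rec_ext (total_rec_eq (total_rec_count Pr Kr) Kr).
by move=> v _; rewrite all_count size_iota.
Qed.

Lemma total_rec_has n (P : nat -> seq nat -> bool) K :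
  total_rec n.+1 (fun w => P (head 0 w) (behead w)) -> total_rec n K ->
  total_rec n (fun v => has (P ^~ v) (iota 0 (K v))).
Proof.
move=> Pr Kr; apply: total_rec_ext
  (total_rec_leq (total_rec_cst n 1) (total_rec_count Pr Kr)).
by move=> v _; rewrite has_count.
Qed.

(** The index of the first hit is the number of initial segments without a hit; both are [k] when
    there is no hit. This reduces bounded search to bounded counting. *)
Lemma count_find_iota (P : pred nat) k :
  count (fun i => ~~ has P (iota 0 i.+1)) (iota 0 k) = find P (iota 0 k).
Proof.
elim: k => // k IH.
rewrite -[in LHS]addn1 -[in RHS]addn1 !iotaD count_cat find_cat IH.
have hasS : has P (iota 0 k.+1) = has P (iota 0 k) || P k.
  by rewrite -addn1 iotaD has_cat [X in _ || X]orbF.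
have -> : count (fun i => ~~ has P (iota 0 i.+1)) (iota (0 + k) 1)
          = ~~ (has P (iota 0 k) || P k) by rewrite -hasS [LHS]addn0.
by case: ifPn => [_|/hasNfind->]; rewrite ?addn0 //= size_iota; case: (P k).
Qed.

Lemma total_rec_find n (P : nat -> seq nat -> bool) K :
  total_rec n.+1 (fun w => P (head 0 w) (behead w)) -> total_rec n K ->
  total_rec n (fun v => find (P ^~ v) (iota 0 (K v))).
Proof.
move=> Pr Kr; pose Q i v := ~~ has (P ^~ v) (iota 0 i.+1).
apply: total_rec_ext (total_rec_count (P := Q) _ Kr).
  by move=> v _; rewrite -count_find_iota.
apply/total_rec_neg/(total_rec_has (P := fun j w => P j (behead w))); last first.
  by apply: total_rec_succ; total_rec_leaf.
exact: (total_rec_skip Pr).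
Qed.

(** The quotient counts the [i] below [F v] with [i.+1 * G v <= F v]; the guard [0 < G v] matches
    the convention that dividing by 0 gives 0. *)
Lemma total_rec_div n F G :
  total_rec n F -> total_rec n G -> total_rec n (fun v => F v %/ G v).
Proof.
move=> Fr Gr.
apply: total_rec_ext (total_rec_count
  (P := fun i v => (0 < G v) && (i.+1 * G v <= F v)) _ Fr).
  move=> v _; have [->|Gv] := posnP (G v).
    by rewrite divn0; elim: (iota _ _).
  rewrite (eq_count (a2 := fun i => i < F v %/ G v)); last first.
    by move=> i /=; rewrite leq_divRL.
  have le := leq_div (F v) (G v); move: (F v) (F v %/ G v) le => k q.
  move=> /subnKC<-; rewrite iotaD count_cat.
  rewrite (eq_in_count (a2 := xpredT)); last first.
    by move=> i; rewrite mem_iota add0n => /andP[_ ->].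
  rewrite count_predT size_iota (eq_in_count (a2 := xpred0)); last first.
    by move=> i; rewrite mem_iota add0n => /andP[qi _]; rewrite ltnNge qi.
  by rewrite count_pred0 addn0.
apply: total_rec_and; first by apply: total_rec_leq; total_rec_leaf.
apply: total_rec_leq; last by total_rec_leaf.
by apply: total_rec_mul; [apply: total_rec_succ|]; total_rec_leaf.
Qed.

Lemma total_rec_odd n F :
  total_rec n F -> total_rec n (fun v => odd (F v)).
Proof.
move=> Fr; apply: total_rec_ext (total_rec_sub Fr
  (total_rec_mul (total_rec_div Fr (total_rec_cst n 2)) (total_rec_cst n 2))).
by move=> v _; rewrite -modn2 {1}(divn_eq (F v) 2) addKn.
Qed.

(** * Stagewise evaluation of partial recursive functions *)

Lemma total_rec_mkseq m n F (G : nat -> seq nat -> nat) :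
  total_rec m F -> (forall i, total_rec n (G i)) ->
  total_rec n (fun v => F (mkseq (G ^~ v) m)).
Proof.
move=> Fr Gr.
apply: total_rec_ext (total_rec_comp Fr (G := fun i => G (val i)) _) => // v _.
by rewrite /mkseq -val_enum_ord -map_comp.
Qed.

Lemma total_rec_comp_cons m n F (H : seq nat -> nat) (G : 'I_m -> seq nat -> nat) :
  total_rec m.+1 F -> total_rec n H -> (forall i, total_rec n (G i)) ->
  total_rec n (fun v => F (H v :: [seq G i v | i <- enum 'I_m])).
Proof.
move=> Fr Hr Gr.
pose G' (i : 'I_m.+1) := if unlift ord0 i is Some j then G j else H.
apply: total_rec_ext (total_rec_comp Fr (G := G') _).
  move=> v _; rewrite enum_ordSl /= -map_comp /G' unlift_none; congr (F (_ :: _)).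
  by apply: eq_map => i; rewrite /= liftK.
by move=> i; rewrite /G'; case: unliftP.
Qed.

(** At stage [s] the value 0 means that there is no result yet, and [y.+1] that the computation has
    halted with [y]. *)
Definition approximates n (f : recfn n) (T : seq nat -> nat) : Prop :=
  [/\ total_rec n.+1 T,
      forall s s' v y, (s <= s') -> T (s :: v) = y.+1 -> T (s' :: v) = y.+1
    & forall (v : n.-tuple nat) y,
        rec_eval f v y <-> exists s, T (s :: v) = y.+1].

Lemma approximates_comp m n (f : recfn m) (g : 'I_m -> recfn n) Tf
    (Tg : 'I_m -> seq nat -> nat) :
  approximates f Tf -> (forall i, approximates (g i) (Tg i)) ->
  approximates (RComp f g)
    (fun w => if all (fun i => 0 < Tg i w) (enum 'I_m)
              then Tf (head 0 w :: [seq (Tg i w).-1 | i <- enum 'I_m]) else 0).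
Proof.
move=> [fr fm fP] gA; split.
- apply: total_rec_if; last exact: total_rec_cst.
  + elim: (enum 'I_m) => [|i l IH] /=; first exact: total_rec_cst.
    apply: total_rec_and IH; apply: total_rec_leq; first exact: total_rec_cst.
    by have [] := gA i.
  + apply: (total_rec_comp_cons (G := fun i w => (Tg i w).-1)) fr _ _.
      exact: total_rec_head.
    by move=> i; apply: total_rec_pred; have [] := gA i.
- move=> s s' v y ss' /=; case: ifP => // /allP gpos fy.
  have E i : Tg i (s' :: v) = Tg i (s :: v).
    have := gpos i; rewrite mem_enum => /(_ isT).
    case Ei: (Tg i (s :: v)) => [|z] // _.
    by have [_ gm _] := gA i; apply: gm Ei.
  rewrite ifT; last by apply/allP => i im; rewrite E gpos.
  by rewrite (eq_map (fun i => congr1 predn (E i))); apply: fm fy.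
- move=> v y /=; split.
  + move=> [w [gw /fP[s0 fy]]].
    have /choice[s sP] i : exists s, Tg i (s :: v) = (tnth w i).+1.
      by have [_ _ gP] := gA i; apply/gP/gw.
    pose S := maxn s0 (\max_i s i).
    have E i : Tg i (S :: v) = (tnth w i).+1.
      have [_ gm _] := gA i; apply: gm (sP i).
      by rewrite leq_max (leq_bigmax i) orbT.
    exists S; rewrite ifT; last by apply/allP => i _; rewrite E.
    rewrite (eq_map (fun i => congr1 predn (E i))) map_tnth_enum.
    by apply: fm fy; rewrite leq_maxl.
  + move=> [s]; case: ifP => // /allP gpos fy.
    exists [tuple (Tg i (s :: v)).-1 | i < m]; split; last by apply/fP; exists s.
    move=> i; have [_ _ gP] := gA i; rewrite tnth_mktuple; apply/gP; exists s.
    by rewrite prednK // gpos // mem_enum.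
Qed.

(** The whole recursion runs at one fixed stage; a 0 at any level, an unfinished subcomputation, is
    passed on to the end. *)
Lemma approximates_prim n (f : recfn n) (g : recfn n.+2) Tf Tg :
  approximates f Tf -> approximates g Tg ->
  approximates (RPrim f g)
    (fun w => nat_rect (fun=> nat) (Tf (head 0 w :: behead (behead w)))
       (fun k z => if 0 < z
          then Tg [:: head 0 w, k, z.-1 & behead (behead w)] else 0)
       (head 0 (behead w))).
Proof.
move=> [fr fm fP] [gr gm gP]; split.
- apply: (total_rec_prim (G := fun k z w =>
    if 0 < z then Tg [:: head 0 w, k, z.-1 & behead (behead w)] else 0)).
  + exact: total_rec_skip fr.
  + apply: total_rec_if; last exact: total_rec_cst.
      by apply: total_rec_leq; total_rec_leaf.
    (* The list here consists of [k], [z], the stage, the recursion argument and the parameters; [G]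
       rearranges it for [Tg] and drops the recursion argument. *)
    pose G i w := match i with 0 => nth 0 w 2 | 1 => nth 0 w 0
                             | 2 => (nth 0 w 1).-1 | k.+3 => nth 0 w k.+4 end.
    have Gr i : total_rec n.+4 (G i).
      by case: i => [|[|[|i]]]; rewrite /G; try apply: total_rec_pred;
         exact: total_rec_nth.
    apply: total_rec_ext (total_rec_mkseq gr Gr).
    move=> [|x [|y [|z [|t v]]]] //= [sv]; congr Tg.
    apply: (@eq_from_nth _ 0); first by rewrite size_mkseq /= sv.
    by rewrite size_mkseq => -[|[|[|i]]] ilt; rewrite nth_mkseq.
  + exact: total_rec_head2.
- move=> s s' [|k v] y ss' /=; first exact: fm.
  elim: k y => /= [|k IH] y; first exact: fm.
  case: ifP => // ; set z := nat_rect _ _ _ _ => z0.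
  move: (erefl z); rewrite {2}/z -(prednK z0) => /esym/IH->.
  by apply: gm.
- case/tupleP=> k v y /=; rewrite theadE.
  have -> : behead_tuple (cons_tuple k v) = v by apply: val_inj.
  pose R s k := nat_rect (fun=> nat) (Tf (s :: v))
       (fun k z => if 0 < z then Tg [:: s, k, z.-1 & v] else 0) k.
  have Rm s s' k' z : s <= s' -> R s k' = z.+1 -> R s' k' = z.+1.
    move=> ss'; elim: k' z => /= [|k' IH] z; first exact: fm.
    case: ifP => // z0; rewrite -(prednK z0) in IH *.
    by rewrite (IH _ erefl); apply: gm.
  rewrite -/(R _ _); elim: k y => [|k IH] y /=; first exact: fP.
  split.
  + move=> [z /IH[s1 Rz]] /gP[s2 gy]; exists (maxn s1 s2).
    rewrite /R /= -/(R _ _) (Rm _ _ _ _ (leq_maxl _ _) Rz) /=.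
    exact: gm (leq_maxr _ _) gy.
  + move=> [s]; case: ifP => // z0 gy; exists (R s k).-1.
      by apply/IH; exists s; rewrite prednK.
    by apply/gP; exists s.
Qed.

Lemma approximates_min n (f : recfn n.+1) Tf :
  approximates f Tf ->
  exists T, approximates (RMin f) T.
Proof.
move=> [fr fm fP].
(* A value below 2 is either 0, not yet computed, or 1, the result 0. The search stops at the first
   such [y], and [T] answers only in the second case. If nothing is found, [Y w] is the stage
   itself, tested as one more candidate. *)
pose Y w := find (fun y => Tf [:: head 0 w, y & behead w] < 2)
                 (iota 0 (head 0 w)).
pose T w := if Tf [:: head 0 w, Y w & behead w] == 1 then (Y w).+1 else 0.
have TP s v y : T (s :: v) = y.+1 <->
    [/\ y <= s, Tf [:: s, y & v] = 1
      & forall k, k < y -> 2 <= Tf [:: s, k & v]].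
  rewrite /T /Y /=; set P := fun y => Tf _ < 2.
  have fs : find P (iota 0 s) <= s by rewrite -[X in _ <= X](size_iota 0 s) find_size.
  split.
    case: eqP => // f1 [<-]; split => // k kf.
    have := before_find 0 kf; rewrite nth_iota ?(leq_trans kf) // add0n /P.
    by rewrite ltnNge => /negbFE.
  move=> [ys fy fk]; suff -> : find P (iota 0 s) = y by rewrite fy eqxx.
  apply/eqP; rewrite eqn_leq; apply/andP; split.
    rewrite leqNgt; apply/negP => yf; have := before_find 0 yf.
    by rewrite nth_iota ?(leq_trans yf) // add0n /P fy.
  rewrite leqNgt; apply/negP => fy'.
  have: has P (iota 0 s) by rewrite has_find size_iota (leq_trans fy').
  move/(nth_find 0); rewrite nth_iota ?(leq_trans fy') // add0n /P.
  by rewrite ltnNge fk.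
exists T; split.
- have Tr : total_rec n.+2 (fun w => Tf [:: head 0 (behead w), head 0 w & behead (behead w)]).
    pose G i w := match i with 0 => nth 0 w 1 | 1 => nth 0 w 0
                             | k.+2 => nth 0 w k.+2 end.
    have Gr i : total_rec n.+2 (G i).
      by case: i => [|[|i]]; rewrite /G; exact: total_rec_nth.
    apply: total_rec_ext (total_rec_mkseq fr Gr).
    move=> [|x [|y v]] //= [sv]; congr Tf.
    apply: (@eq_from_nth _ 0); first by rewrite size_mkseq /= sv.
    by rewrite size_mkseq => -[|[|i]] ilt; rewrite nth_mkseq.
  have Yr : total_rec n.+1 Y.
    apply: (total_rec_find (P := fun y w => Tf [:: head 0 w, y & behead w] < 2)).
      by apply: total_rec_leq; [apply: total_rec_succ | apply: total_rec_cst].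
    exact: total_rec_head.
  apply: total_rec_if; last exact: total_rec_cst.
    apply: total_rec_eq; last exact: total_rec_cst.
    exact: (total_rec_cut Tr Yr).
  exact: total_rec_succ.
- move=> s s' v y ss' /TP[ys f1 f2]; apply/TP; split.
  + exact: leq_trans ss'.
  + exact: fm f1.
  + move=> k /f2; case E: (Tf _) => [|[|z]] // _.
    by rewrite (fm _ _ _ _ ss' E).
- move=> v y /=; split.
  + move=> [/fP[s0 f0] fk].
    have /choice[s sP] (k : 'I_y) : exists s, exists z, Tf [:: s, val k & v] = z.+2.
      by have [z /fP[s sz]] := fk k (ltn_ord k); exists s, z.
    exists (maxn (maxn y s0) (\max_k s k)); apply/TP; split.
    * by rewrite !leq_max leqnn.
    * by apply: fm f0; rewrite !leq_max leqnn orbT.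
    * move=> k ky; have [z sz] := sP (Ordinal ky).
      rewrite (fm _ _ _ _ _ sz) // leq_max; apply/orP; right.
      exact: (leq_bigmax (Ordinal ky)).
  + move=> [s /TP[ys f1 f2]]; split; first by apply/fP; exists s.
    move=> k /f2; case E: (Tf _) => [|[|z]] // _.
    by exists z; apply/fP; exists s.
Qed.

Lemma approximable n (f : recfn n) : exists T, approximates f T.
Proof.
elim: f => {n} [||n i|m n f [Tf fA] g gA|n f [Tf fA] g [Tg gA]|n f [Tf fA]].
- exists (fun=> 1); split => //; first exact: total_rec_cst.
  by move=> v y /=; split => [->|[_ [->]]] //; exists 0.
- exists (fun w => (nth 0 w 1).+2); split => //.
    by do 2!apply: total_rec_succ; exact: total_rec_nth.
  by case/tupleP=> x v y /=; split => [->|[_ [<-]]] //; exists 0.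
- exists (fun w => (nth 0 w i.+1).+1); split => //.
    by apply: total_rec_succ; exact: total_rec_nth.
  by move=> v y /=; rewrite (tnth_nth 0); split => [->|[_ [<-]]] //; exists 0.
- have /choice[Tg TgA] := gA; eexists; exact: approximates_comp fA TgA.
- by eexists; exact: approximates_prim fA gA.
- exact: approximates_min fA.
Qed.

(** Both results are present at the larger of two stages at which they have appeared. *)
Lemma rec_eval_fun n (f : recfn n) v y z :
  rec_eval f v y -> rec_eval f v z -> y = z.
Proof.
have [T [_ Tm TP]] := approximable f.
move=> /TP[s sy] /TP[t tz].
have := Tm _ _ _ _ (leq_maxl s t) sy.
by rewrite (Tm _ _ _ _ (leq_maxr s t) tz) => -[].
Qed.

(** [A] is the domain of the search for an [s] with [P s n]; [P] is negated because [RMin] looks for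
    the value 0. *)
Lemma total_rec_ce (A : set nat) (P : nat -> nat -> bool) :
  total_rec 2 (fun w => P (head 0 w) (head 0 (behead w))) ->
  (forall n, A n <-> exists s, P s n) -> computably_enumerable A.
Proof.
move=> /total_rec_neg[g gP] AP; exists (RMin g) => n; rewrite AP.
split => [[s Ps]|[s /= [g0 _]]].
  pose s0 := ex_minn (ex_intro (P ^~ n) s Ps); exists s0.
  rewrite /s0; case: ex_minnP => m Pm mmin /=; split.
    by have := gP [tuple m; n]; rewrite /= Pm.
  move=> k km; exists 0; have := gP [tuple k; n].
  rewrite /=; case: (boolP (P k n)) => // /mmin.
  by rewrite leqNgt km.
exists s; have := gP (cons_tuple s [tuple n]).
by move/(rec_eval_fun g0) => /=; case: (P s n).
Qed.

Lemma total_rec_computable (h : nat -> nat) :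
  total_rec 1 (fun v => h (head 0 v)) -> computable h.
Proof. by move=> [f fP]; exists f => n; exact: (fP [tuple n]). Qed.

(** * Codes of strings and Kraft's inequality *)

Lemma code_str_rcons s b : code_str (rcons s b) = (code_str s).*2 + b.
Proof. by rewrite /code_str foldl_rcons. Qed.

Lemma code_str_bounds s : 2 ^ size s <= code_str s < 2 ^ (size s).+1.
Proof.
elim/last_ind: s => // s b /andP[lo hi]; rewrite code_str_rcons size_rcons.
by rewrite !expnS in lo hi *; apply/andP; case: b; split; lia.
Qed.

Lemma code_str_gt0 s : 0 < code_str s.
Proof. by have /andP[+ _] := code_str_bounds s; apply: leq_trans; rewrite expn_gt0. Qed.

Lemma code_str_onto p : 0 < p -> exists s, code_str s = p.
Proof.
elim/ltn_ind: p => p IH p0; have [p1|p1] := leqP p 1.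
  by exists [::]; rewrite /code_str /=; lia.
have [||s sp] := IH p./2; [lia.. |].
by exists (rcons s (odd p)); rewrite code_str_rcons sp addnC odd_double_half.
Qed.

Lemma code_str_inj : injective code_str.
Proof.
elim/last_ind => [|s b IH] t; elim/last_ind: t => [|t c _] //.
- rewrite code_str_rcons => e; have := code_str_gt0 t; move: e.
  by rewrite {1}/code_str /=; lia.
- rewrite code_str_rcons => e; have := code_str_gt0 s; move: e.
  by rewrite {2}/code_str /=; lia.
- rewrite !code_str_rcons => e.
  have bc : b = c by move: (congr1 odd e); rewrite !oddD !odd_double !oddb.
  by rewrite bc in e *; congr rcons; apply: IH; lia.
Qed.

(** Together with the next two lemmas, this turns padding with zeros, padding with ones and
    truncation into arithmetic on codes. *)
Lemma code_str_cat_false s k :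
  code_str (s ++ nseq k false) = code_str s * 2 ^ k.
Proof.
elim: k s => [|k IH] s; first by rewrite cats0 muln1.
by rewrite -cat_rcons IH code_str_rcons expnS; lia.
Qed.

Lemma code_str_cat_true s k :
  code_str (s ++ nseq k true) = ((code_str s).+1 * 2 ^ k).-1.
Proof.
elim: k s => [|k IH] s; first by rewrite cats0 muln1.
by rewrite -cat_rcons IH code_str_rcons expnS; congr predn; lia.
Qed.

Lemma code_str_cat_div s t : code_str (s ++ t) %/ 2 ^ size t = code_str s.
Proof.
elim/last_ind: t => [|t b IH]; first by rewrite cats0 divn1.
rewrite -rcons_cat code_str_rcons size_rcons expnS divnMA.
by rewrite -[RHS]IH; congr (_ %/ _); case: b; lia.
Qed.

(** Kraft's inequality multiplied by [2 ^ L], by induction on [L]: a prefix-free set containing the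
    empty string has no other element, and any other one splits by the first bit into two
    prefix-free sets of shorter strings. *)
Lemma kraft_nat L (S : seq bitseq) :
  uniq S -> {in S &, forall p q, prefix p q -> p = q} ->
  {in S, forall p, size p <= L} ->
  \sum_(p <- S) 2 ^ (L - size p) <= 2 ^ L.
Proof.
have nilS (T : seq bitseq) : uniq T -> [::] \in T ->
    {in T &, forall p q, prefix p q -> p = q} -> T = [:: [::]].
  move=> uT nT pT; apply: perm_small_eq => //; apply: uniq_perm => // p.
  rewrite inE; apply/idP/eqP => [pT'|->//].
  by rewrite [RHS](pT _ _ nT pT') ?prefix0s.
elim: L S => [|L IH] S uS pS sS.
  case: S uS pS sS => [|p S] uS pS sS; first by rewrite big_nil.
  have nS : [::] \in p :: S.
    have := sS p (mem_head _ _); rewrite leqn0 => /nilP {1}<-.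
    exact: mem_head.
  by rewrite (nilS _ uS nS pS) big_seq1.
have [nS|nS] := boolP ([::] \in S).
  by rewrite (nilS _ uS nS pS) big_seq1 subn0.
have consS p : p \in S -> p = head false p :: behead p.
  by case: p => // /(negP nS).
have half b : \sum_(p <- S | head false p == b) 2 ^ (L.+1 - size p) <= 2 ^ L.
  pose Sb := [seq behead p | p <- S & head false p == b].
  have SbP q : q \in Sb -> b :: q \in S.
    move=> /mapP[p]; rewrite mem_filter => /andP[/eqP pb pinS] ->.
    by rewrite -pb -consS.
  rewrite -big_filter (_ : \sum_(p <- _) _ = \sum_(q <- Sb) 2 ^ (L - size q)).
    apply: IH.
    - rewrite map_inj_in_uniq ?filter_uniq // => p q.
      rewrite !mem_filter => /andP[/eqP pb pinS] /andP[/eqP qb qinS] e.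
      by rewrite (consS p) // (consS q) // e pb qb.
    - move=> p q /SbP pinS /SbP qinS pq.
      have : b :: p = b :: q by apply: pS => //; rewrite /= eqxx.
      by case.
    - by move=> q /SbP/sS.
  rewrite big_map big_seq [RHS]big_seq; apply: eq_bigr => p.
  by rewrite mem_filter => /andP[_ /consS->].
rewrite (bigID (fun p => head false p == true)) /= expnS mul2n -addnn.
apply: leq_add; first exact: half.
by rewrite (eq_bigl (fun p => head false p == false)) ?half // => p; case: head.
Qed.

Local Open Scope ring_scope.

Lemma kraft (F : realFieldType) (S : seq bitseq) :
  uniq S -> {in S &, forall p q, prefix p q -> p = q} ->
  \sum_(p <- S) (2 ^+ size p)^-1 <= 1 :> F.
Proof.
move=> uS pS; pose L := (\max_(p <- S) size p)%N.
have sS : {in S, forall p, (size p <= L)%N}.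
  by move=> p pinS; apply: leq_bigmax_seq.
have L0 : 0 < 2 ^+ L :> F by rewrite exprn_gt0.
rewrite -(ler_pM2l L0) mulr1 mulr_sumr.
have := kraft_nat uS pS sS; rewrite -(ler_nat F) natrX natr_sum.
apply: le_trans; rewrite big_seq [leRHS]big_seq; apply: ler_sum => p /sS pL.
by rewrite natrX expfB_cond ?pnatr_eq0 ?subnK //.
Qed.

(** Each of the [k] dyadic ranges [[M, 2M[] has [M] terms, all at least [1 / (2M)]. *)
Lemma harmonic_ge (F : realFieldType) m k :
  k%:R / 2 <= \sum_(2 ^ m <= n < 2 ^ (m + k)) n%:R^-1 :> F.
Proof.
elim: k => [|k IH]; first by rewrite mul0r sumr_ge0.
have le1 : (2 ^ m <= 2 ^ (m + k))%N by rewrite leq_exp2l ?leq_addr.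
have le2 : (2 ^ (m + k) <= 2 ^ (m + k.+1))%N by rewrite leq_exp2l ?addnS.
rewrite (big_cat_nat le1 le2) /= -natr1 mulrDl; apply: lerD => //.
set M := (2 ^ (m + k))%N.
have -> : (2 ^ (m + k.+1))%N = (M + M)%N by rewrite addnS expnS mul2n addnn.
have M0 : 0 < M%:R :> F by rewrite ltr0n expn_gt0.
have -> : 1 / 2 = \sum_(M <= n < M + M) (M + M)%:R^-1 :> F.
  rewrite sumr_const_nat addnK -[RHS]mulr_natl natrD.
  by field; rewrite gt_eqF // addr_gt0.
rewrite !big_nat; apply: ler_sum => n /andP[Mn nM].
have n0 : 0 < n%:R :> F by rewrite ltr0n (leq_trans _ Mn) // expn_gt0.
rewrite lef_pV2 ?posrE //; first by rewrite ler_nat ltnW.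
by rewrite natrD addr_gt0.
Qed.

(** The first factor counts the [x < n] in the block; the second bounds from below the Kraft weight
    of a short program for a string of length [n]. The constant 16 suffices: the estimate leaves
    [4 * (1 - 2 ^- s)], which is at least 2. *)
Lemma block_weight (F : realFieldType) s : (0 < s)%N ->
  1 < \sum_(2 ^ 2 ^ s <= n < 2 ^ 2 ^ s.+1)
        (n - 2 ^ 2 ^ s)%:R * (16 / (n%:R ^+ 2 * 2 ^+ s)) :> F.
Proof.
move=> s0; set b := (2 ^ 2 ^ s)%N.
have b0 : (0 < b)%N by rewrite expn_gt0.
have t2 : (2 <= 2 ^ s)%N by rewrite -{1}(expn1 2) leq_exp2l.
have eS : (2 ^ s.+1 = (2 ^ s).+1 + (2 ^ s).-1)%N by rewrite expnS; lia.
have le1 : (b <= 2 ^ (2 ^ s).+1)%N by rewrite leq_exp2l.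
have le2 : (2 ^ (2 ^ s).+1 <= 2 ^ 2 ^ s.+1)%N by rewrite leq_exp2l // eS leq_addr.
have term_ge0 n : 0 <= (n - b)%:R * (16 / (n%:R ^+ 2 * 2 ^+ s)) :> F.
  by rewrite mulr_ge0 // divr_ge0 // mulr_ge0 ?exprn_ge0.
(* The [n] below [2 * b] are discarded; for the others [n - b] is at least [n / 2]. *)
rewrite (big_cat_nat le1 le2) /=; apply: ltr_wpDl; first exact: sumr_ge0.
have h := harmonic_ge F (2 ^ s).+1 (2 ^ s).-1; rewrite -eS in h.
have S0 : 0 < 2 ^+ s :> F by rewrite exprn_gt0.
have St : (2 ^ s)%:R = 2 ^+ s :> F by rewrite natrX.
apply: (@lt_le_trans _ _
  (8 / 2 ^+ s * \sum_(2 ^ (2 ^ s).+1 <= n < 2 ^ 2 ^ s.+1) n%:R^-1)); last first.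
  rewrite mulr_sumr !big_nat; apply: ler_sum => n /andP[bn _].
  have nb : (b.*2 <= n)%N by rewrite -mul2n -expnS.
  have n0 : 0 < n%:R :> F by rewrite ltr0n; lia.
  have -> : 8 / 2 ^+ s * n%:R^-1 = n%:R / 2 * (16 / (n%:R ^+ 2 * 2 ^+ s)) :> F.
    by field; rewrite !gt_eqF.
  apply: ler_wpM2r; first by rewrite divr_ge0 // mulr_ge0 ?exprn_ge0 // ltW.
  rewrite ler_pdivrMr // -natrM ler_nat; lia.
apply: (@lt_le_trans _ _ (8 / 2 ^+ s * ((2 ^ s).-1%:R / 2))); last first.
  by rewrite ler_wpM2l // divr_ge0 // ltW.
rewrite -subn1 natrB ?St; last by lia.
have S2 : 2 <= 2 ^+ s :> F by rewrite -St ler_nat.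
by rewrite mulrAC ltr_pdivlMr // mul1r; move: (2 ^+ s) S2 => x x2; lra.
Qed.

Local Close Scope ring_scope.

(** * The construction *)

(** For [n] in [[block j, block j.+1[] the value [binlog (binlog n)] is [j] up to a constant, and
    the interval spans [2 ^ j] doublings. *)
Definition block j := 2 ^ 2 ^ j.

Lemma ltn_block j k : (block j < block k) = (j < k).
Proof. by rewrite /block !ltn_exp2l. Qed.

Lemma leq_block j k : (block j <= block k) = (j <= k).
Proof. by rewrite /block !leq_exp2l. Qed.

Lemma ltn_id_block j : j < block j.
Proof. by apply: (ltn_trans (ltn_expl j (isT : 1 < 2))); exact: ltn_expl. Qed.

Lemma block_unique j k x :
  block j <= x < block j.+1 -> block k <= x < block k.+1 -> j = k.
Proof.
move=> /andP[jx xj] /andP[kx xk]; apply/eqP; rewrite eqn_leq -(ltnS j) -(ltnS k).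
by rewrite -(ltn_block j) -(ltn_block k) (leq_ltn_trans jx xk) (leq_ltn_trans kx xj).
Qed.

Lemma short_code_weight (F : realFieldType) k n s : 0 < n ->
  2 ^ k * 16 < n ^ 2 * 2 ^ s ->
  (16 / (n%:R ^+ 2 * 2 ^+ s) <= (2 ^+ k)^-1 :> F)%R.
Proof.
move=> n0 lt; rewrite ler_pdivrMr; last first.
  by rewrite mulr_gt0 ?exprn_gt0 // ltr0n.
rewrite mulrC ler_pdivlMr ?exprn_gt0 // mulrC.
by move: lt; rewrite -(ltr_nat F) !natrM !natrX => /ltW.
Qed.

Section Construction.
Variable T : nat -> nat -> nat.

(** Here [p] is the code of a program whose output, with code [w], has appeared by stage [s]; 0
    codes no string. Since [p] is at least 2 to the length of the program, that length is below
    [2 * log2 n + j - 4]. *)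
Definition described s w n j :=
  has (fun p => [&& 0 < p, p * 16 < n ^ 2 * 2 ^ j & T s p == w.+1])
      (iota 0 (n ^ 2 * 2 ^ j)).

Definition prefix_code (a : nat -> bool) n := code_str (mkseq a n).

Definition requests s a x :=
  has (fun j => [&& block j <= x, x < block j.+1, ~~ a x,
         all (fun y => (x < y) ==> a y) (iota 0 (block j.+1))
       & all (fun n => (block j <= n) ==> described s (prefix_code a n) n j)
             (iota 0 (block j.+1))])
      (iota 0 s).

(** A block can request only its largest missing element, so the least [x] comes from the least
    requesting block. Without a request, the default [block s.+1] makes the interval dumped at stage
    [s] empty. *)
Definition least_request s a :=
  let x := find (requests s a) (iota 0 (block s)) in
  if x < block s then x else block s.+1.

Fixpoint stage_set s : nat -> bool :=
  if s is s'.+1 then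
    fun m => stage_set s' m || (least_request s' (stage_set s') <= m < block s)
  else fun=> false.

Definition action s := least_request s (stage_set s).

Definition limit_set : set nat := [set m | exists s, stage_set s m]%classic.

Lemma stage_setS s m : stage_set s.+1 m = stage_set s m || (action s <= m < block s.+1).
Proof. by []. Qed.

Lemma requestsP s a x :
  reflect (exists j, [/\ j < s, block j <= x < block j.+1, ~~ a x,
      forall y, x < y < block j.+1 -> a y
    & forall n, block j <= n < block j.+1 -> described s (prefix_code a n) n j])
    (requests s a x).
Proof.
apply: (iffP hasP) => [[j + /and5P[bx xb ax /allP ay /allP an]]|].
  rewrite mem_iota => /= js; exists j; split; rewrite ?bx //.
  - by move=> y /andP[xy yj]; move: (ay y); rewrite mem_iota yj xy; apply.
  - by move=> n /andP[jn nj]; move: (an n); rewrite mem_iota nj jn; apply.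
move=> [j [js /andP[bx xb] ax ay an]]; exists j; first by rewrite mem_iota.
rewrite bx xb ax; apply/and5P; split=> //; apply/allP => y; rewrite mem_iota /=.
  by move=> yj; apply/implyP => xy; rewrite ay ?xy.
by move=> yj; apply/implyP => xy; rewrite an ?xy.
Qed.

Lemma describedP s w n j :
  reflect (exists p, [/\ 0 < p, p * 16 < n ^ 2 * 2 ^ j & T s p = w.+1])
    (described s w n j).
Proof.
apply: (iffP hasP) => [[p _ /and3P[p0 ps /eqP Tp]]|[p [p0 ps Tp]]].
  by exists p.
exists p; last by rewrite p0 ps Tp /=.
by rewrite mem_iota /=; apply: leq_ltn_trans ps; rewrite leq_pmulr.
Qed.

(** * Actions and stable stages *)

Lemma action_requests s : action s < block s.+1 -> requests s (stage_set s) (action s).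
Proof.
rewrite /action /least_request; case: ifP => [fs _|_]; last by rewrite ltnn.
have hs : has (requests s (stage_set s)) (iota 0 (block s)).
  by rewrite has_find size_iota.
by have := nth_find 0 hs; rewrite nth_iota.
Qed.

Lemma action_le s x : x < block s -> requests s (stage_set s) x -> action s <= x.
Proof.
move=> xs rx; have fx : find (requests s (stage_set s)) (iota 0 (block s)) <= x.
  rewrite leqNgt; apply/negP => /(before_find 0).
  by rewrite nth_iota // rx.
by rewrite /action /least_request (leq_ltn_trans fx xs).
Qed.

Lemma stage_set_bound s m : stage_set s m -> m < block s.
Proof.
elim: s => // s IH /orP[/IH ms|/andP[]//].
by apply: ltn_trans ms _; rewrite ltn_block.
Qed.

Lemma stage_set_action s : ~~ stage_set s (action s).
Proof.
have [/action_requests/requestsP[j []]//|le] := ltnP (action s) (block s.+1).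
apply/negP => /stage_set_bound; apply/negP; rewrite -leqNgt (leq_trans _ le) //.
by rewrite leq_block.
Qed.

Lemma stage_set_mono s t m : s <= t -> stage_set s m -> stage_set t m.
Proof.
move=> /subnKC <-; elim: (t - s) => [|k IH]; first by rewrite addn0.
by move=> /IH; rewrite addnS stage_setS => ->.
Qed.

Lemma stage_set_change s t m : s <= t -> stage_set t m ->
  stage_set s m \/ exists r, [/\ s <= r, r < t & action r <= m].
Proof.
move=> /subnKC <-; elim: (t - s) => [|k IH]; first by rewrite addn0; left.
rewrite addnS stage_setS => /orP[/IH[|[r [sr rk rm]]]|/andP[am _]]; first by left.
  by right; exists r; split => //; exact: ltnW.
by right; exists (s + k); rewrite leq_addr.
Qed.

(** Actions are the left ends of the dumped intervals, so the set is frozen below [block s] from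
    stage [s] on. *)
Definition stable s := forall t, s <= t -> block s <= action t.

(* A stage whose action is minimal among all later actions is a true stage in
   the sense of Dekker; dumping makes the stage after it stable. *)
Lemma exists_stable s0 : exists2 s, s0 < s & stable s.
Proof.
pose P m := `[< exists2 s, s0 <= s & action s = m >].
have exP : exists m, P m by exists (action s0); apply/asboolP; exists s0.
case: (ex_minnP exP) => m /asboolP[s s0s sm] mmin.
exists s.+1 => // t st; rewrite leqNgt; apply/negP => ts.
have := stage_set_action t; apply/negP; rewrite negbK.
apply: (stage_set_mono st); rewrite stage_setS ts sm.
have -> : m <= action t; last by rewrite orbT.
by apply: mmin; apply/asboolP; exists t; rewrite // (leq_trans s0s) // ltnW.
Qed.

Lemma stable_stage_set s t m : stable s -> s <= t -> m < block s ->
  stage_set t m = stage_set s m.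
Proof.
move=> ss st ms; apply/idP/idP; last exact: stage_set_mono.
move=> /(stage_set_change st)[//|[r [sr rt]]].
by move=> /(leq_trans (ss _ sr)); rewrite leqNgt ms.
Qed.

Lemma limit_setE s m : (forall t, s <= t -> stage_set t m = stage_set s m) ->
  (m \in limit_set) = stage_set s m.
Proof.
move=> st; apply/idP/idP; rewrite in_setE; last by exists s.
move=> [t am]; have [ts|/ltnW/st <-//] := leqP t s; exact: stage_set_mono am.
Qed.

Hypothesis Tmono : forall s t p y, s <= t -> T s p = y.+1 -> T t p = y.+1.

Lemma described_mono s t w n j : s <= t -> described s w n j -> described t w n j.
Proof.
move=> st /describedP[p [p0 ps Tp]]; apply/describedP; exists p; split => //.
exact: Tmono st Tp.
Qed.

Lemma eq_prefix_code a b n : (forall m, m < n -> a m = b m) ->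
  prefix_code a n = prefix_code b n.
Proof.
move=> ab; congr code_str; apply/eq_in_map => m.
by rewrite mem_iota => /ab.
Qed.

(** * Filling the block of a stable stage from the top *)

Section Block.
Variable s : nat.
Hypothesis s_stable : stable s.
Hypothesis all_described : forall n, block s <= n < block s.+1 ->
  exists t, described t (prefix_code (fun m => m \in limit_set) n) n s.

(** At stage [r] the block misses exactly its elements up to [x]. The next action below [block s.+1]
    has to be [x], the largest missing element, and the request behind it supplies the
    descriptions. *)
Lemma block_step x r : block s <= x < block s.+1 -> s < r ->
  (forall m, m < block s.+1 -> stage_set r m = stage_set s m || (x < m)) ->
  exists q, [/\ r <= q, action q = x,
    forall m, m < block s.+1 -> stage_set q m = stage_set s m || (x < m)
  & forall n, block s <= n < block s.+1 ->
      described q (prefix_code (fun m => stage_set s m || (x < m)) n) n s].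
Proof.
move=> /andP[bx xb] sr ar.
(* Otherwise the set is final below [block s.+1] from stage [r] on. The descriptions of its prefixes
   have all appeared by some stage [t], where [x] is requested, so the action at [t] is at most [x]
   after all. *)
have ex : exists q, (r <= q) && (action q < block s.+1).
  apply: contrapT => /forallNP noq.
  have lim t m : r <= t -> m < block s.+1 -> stage_set t m = stage_set r m.
    move=> rt mb; apply/idP/idP; last exact: stage_set_mono.
    move=> /(stage_set_change rt)[//|[q [rq _ qm]]].
    by case: (noq q); rewrite rq (leq_ltn_trans qm mb).
  have /choice[tt ttP] n : exists t, block s <= n < block s.+1 ->
      described t (prefix_code (fun m => m \in limit_set) n) n s.
    have [/all_described[t nt]|_] := boolP (block s <= n < block s.+1).
      by exists t.
    by exists 0.
  pose t := maxn r (\max_(n < block s.+1) tt n).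
  have rt : r <= t by rewrite leq_maxl.
  have at_ m : m < block s.+1 -> stage_set t m = stage_set s m || (x < m).
    by move=> mb; rewrite lim // ar.
  have bt : block s.+1 <= block t by rewrite leq_block (leq_trans sr).
  apply: (noq t); rewrite rt /=; apply: (leq_ltn_trans _ xb).
  apply: action_le; first exact: leq_trans xb bt.
  apply/requestsP; exists s; split; rewrite ?bx //; first exact: leq_trans sr rt.
  - rewrite at_ // ltnn orbF; apply/negP => /stage_set_bound.
    by rewrite ltnNge bx.
  - by move=> y /andP[xy yb]; rewrite at_ // xy orbT.
  - move=> n /andP[bn nb].
    rewrite (_ : prefix_code _ _ = prefix_code (fun m => m \in limit_set) n).
      apply: (@described_mono (tt n)); last by apply: ttP; rewrite bn.
      by rewrite leq_max (leq_bigmax (Ordinal nb)) orbT.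
    apply: eq_prefix_code => m mn; rewrite -limit_setE // => t' tt'.
    by rewrite !lim ?(leq_trans rt) // (ltn_trans mn).
case: (ex_minnP ex) => q /andP[rq qb] qmin.
(* As [q] is the first such stage, nothing has changed below [block s.+1] since stage [r]. *)
have aq m : m < block s.+1 -> stage_set q m = stage_set s m || (x < m).
  move=> mb; rewrite -ar //; apply/idP/idP; last exact: stage_set_mono.
  move=> /(stage_set_change rq)[//|[t [rt tq tm]]].
  have /qmin : (r <= t) && (action t < block s.+1) by rewrite rt (leq_ltn_trans tm).
  by rewrite leqNgt tq.
(* Stability rules out the lower blocks, so the requesting block is that of [s]. *)
have qB : block s <= action q by apply: s_stable; rewrite (leq_trans _ rq) // ltnW.
have /action_requests/requestsP[j [jq qj nq qy qn]] : action q < block q.+1.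
  by apply: leq_trans qb _; rewrite leq_block ltnS (leq_trans _ rq) // ltnW.
have js : j = s by apply: block_unique qj _; rewrite qB.
subst j.
have qx : action q = x.
  apply/eqP; rewrite eqn_leq; apply/andP; split.
    by move: nq; rewrite aq // negb_or -leqNgt => /andP[].
  rewrite leqNgt; apply/negP => qx; have := qy x; rewrite qx xb => /(_ isT).
  rewrite aq // ltnn orbF => /stage_set_bound.
  by rewrite ltnNge bx.
exists q; split => // n nB; have := qn n nB.
rewrite (@eq_prefix_code _ (fun m => stage_set s m || (x < m))) // => m mn.
by apply: aq; apply: ltn_trans mn _; case/andP: nB.
Qed.

(** Induction on the number [i] of top elements already enumerated, one application of [block_step]
    for each. *)
Lemma block_fills i : i <= block s.+1 - block s ->
  exists2 r, s < r & forall m, m < block s.+1 ->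
    stage_set r m = stage_set s m || (block s.+1 - i <= m).
Proof.
elim: i => [_|i IH ib].
  exists s.+1 => // m mb; rewrite stage_setS subn0 (leqNgt (block s.+1)) mb orbF.
  (* Stage [s] serves only blocks [j < s], which lie below [block s], where stability forbids an
     action; so its action is the default. *)
  suff sb : block s.+1 <= action s by rewrite (leqNgt (action s)) (leq_trans mb sb) orbF.
  rewrite leqNgt; apply/negP => /action_requests/requestsP[j [js /andP[_ jx] _ _ _]].
  have := s_stable (leqnn s); rewrite leqNgt => /negP; apply.
  by apply: leq_trans jx _; rewrite leq_block.
have [r sr ar] := IH (ltnW ib).
have xB : block s <= block s.+1 - i.+1 < block s.+1 by lia.
have ar' m : m < block s.+1 ->
    stage_set r m = stage_set s m || (block s.+1 - i.+1 < m).
  by move=> /ar->; congr (_ || _); lia.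
have [q [rq qx aq _]] := block_step xB sr ar'.
exists q.+1; first by rewrite ltnS (leq_trans _ rq) // ltnW.
move=> m mb; rewrite stage_setS aq // qx -orbA; congr (_ || _).
rewrite (leq_trans mb) ?andbT; last by rewrite leq_block ltnS (leq_trans _ rq) // ltnW.
by apply/idP/idP; lia.
Qed.

(** While the block fills up, there is a moment at which it contains exactly its elements above [x];
    the request for [x] then certifies the description. *)
Lemma block_described x n : block s <= x < block s.+1 -> block s <= n < block s.+1 ->
  exists t, described t (prefix_code (fun m => stage_set s m || (x < m)) n) n s.
Proof.
move=> xB nB; have [|r sr ar] := @block_fills (block s.+1 - x.+1); first by lia.
have ar' m : m < block s.+1 -> stage_set r m = stage_set s m || (x < m).
  by move=> /ar->; congr (_ || _); lia.
by have [q [_ _ _ dq]] := block_step xB sr ar'; exists q; apply: dq.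
Qed.
End Block.

(* The strings [stage_set s U ]x, oo[] cut at n, for x < n in the block of s, are
   pairwise distinct, so their descriptions violate Kraft's inequality. *)
Lemma stable_not_described (U : recfn 1) s :
  (forall p y, rec_eval U [tuple p] y <-> exists s, T s p = y.+1) ->
  prefix_free_machine U -> 0 < s -> stable s ->
  exists2 n, block s <= n < block s.+1 &
    forall t, ~~ described t (prefix_code (fun m => m \in limit_set) n) n s.
Proof.
move=> UT Upf s0 ss; apply: contrapT => noN.
have dlim n : block s <= n < block s.+1 ->
    exists t, described t (prefix_code (fun m => m \in limit_set) n) n s.
  move=> nB; apply: contrapT => /forallNP nd; apply: noN; exists n => // t.
  exact/negP/nd.
pose str n x := mkseq (fun m => stage_set s m || (x < m)) n.
have /choice[pi piP] (i : nat * nat) : exists p,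
    block s <= i.2 < i.1 -> i.1 < block s.+1 ->
    run U p (str i.1 i.2) /\ 2 ^ size p * 16 < i.1 ^ 2 * 2 ^ s.
  case: i => n x /=; have [/andP[sx xn]|_] := boolP (block s <= x < n); last first.
    by exists [::].
  have [nb|_] := boolP (n < block s.+1); last by exists [::].
  have [||t /describedP[p [p0 ps Tp]]] := @block_described s ss dlim x n.
  - by rewrite sx (ltn_trans xn).
  - by rewrite nb (leq_trans sx) // ltnW.
  have [q qp] := code_str_onto p0; exists q => _ _; split.
    by rewrite /run qp; apply/UT; exists t.
  (* A code is at least 2 to the length of its string, so the bound on codes passes to lengths. *)
  apply: leq_ltn_trans ps; rewrite leq_mul2r /= -qp.
  by have /andP[] := code_str_bounds q.
pose I := [seq (n, x) | n <- index_iota (block s) (block s.+1),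
                        x <- index_iota (block s) n].
have IP n x : (n, x) \in I -> block s <= x < n /\ n < block s.+1.
  move=> /allpairsPdep[n' [x' [+ + [-> ->]]]].
  by rewrite !mem_index_iota => /andP[_ ->] ->.
have uI : uniq I.
  apply: allpairs_uniq_dep; first exact: iota_uniq.
    by move=> *; apply: iota_uniq.
  by move=> [? ?] [? ?] _ _ [-> ->].
have str_inj n x n' x' : (n, x) \in I -> (n', x') \in I ->
    str n x = str n' x' -> (n, x) = (n', x').
  wlog xx : n x n' x' / x <= x'.
    move=> H i1 i2 e; have [le|/ltnW le] := leqP x x'; first exact: H.
    by apply/esym/H.
  move=> /IP[/andP[sx xn] nb] /IP[/andP[sx' xn'] nb'] e.
  have nn : n = n' by have := congr1 size e; rewrite !size_mkseq.
  subst n'; congr (_, _); apply/eqP; rewrite eqn_leq xx leqNgt; apply/negP => ltx.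
  (* If [x < x'], the strings differ at position [x']: the first has a 1 there, the second a 0,
     because [stage_set s] has no element from [block s] on. *)
  have := congr1 (nth false ^~ x') e; rewrite /= !nth_mkseq // ltx ltnn orbT orbF.
  by move=> /esym/stage_set_bound; rewrite ltnNge sx'.
have pi_inj : {in I &, injective pi}.
  move=> [n x] [n' x'] iI iI' e; apply: str_inj => //.
  have [a b] := IP _ _ iI; have [r1 _] := piP (n, x) a b.
  have [a' b'] := IP _ _ iI'; have [r2 _] := piP (n', x') a' b'.
  by apply: code_str_inj; apply: rec_eval_fun r1 _; rewrite e.
have : (\sum_(p <- [seq pi i | i <- I]) (2 ^+ size p)^-1 <= 1 :> rat)%R.
  apply: kraft; first by rewrite map_inj_in_uniq.
  move=> _ _ /mapP[[n x] iI ->] /mapP[[n' x'] iI' ->].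
  have [a b] := IP _ _ iI; have [r1 _] := piP (n, x) a b.
  have [a' b'] := IP _ _ iI'; have [r2 _] := piP (n', x') a' b'.
  exact: Upf r1 r2.
apply/negP; rewrite -ltNge; apply: lt_le_trans (block_weight rat s0) _.
rewrite big_map big_allpairs_dep /= !big_nat; apply: ler_sum => n /andP[sn nb].
rewrite mulr_natl -sumr_const_nat !big_nat; apply: ler_sum => x xn.
have [_ lt] := piP (n, x) xn nb.
apply: short_code_weight lt.
by rewrite (leq_trans _ sn) // expn_gt0.
Qed.
End Construction.

(** * Computability of the construction *)

Lemma total_rec_app2 (h : nat -> nat -> nat) n F G :
  total_rec 2 (fun w => h (head 0 w) (head 0 (behead w))) ->
  total_rec n F -> total_rec n G -> total_rec n (fun v => h (F v) (G v)).
Proof.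
move=> hr Fr Gr.
by apply: (total_rec_mkseq (G := fun i => if i is 0 then F else G) hr); case.
Qed.

(** Membership is the last bit of a prefix, hence the parity of its code. *)
Lemma odd_prefix_code a m : odd (prefix_code a m.+1) = a m.
Proof. by rewrite /prefix_code mkseqS code_str_rcons oddD odd_double oddb. Qed.

Lemma map_iota_nseq (a : nat -> bool) b m k :
  (forall i, m <= i < m + k -> a i = b) -> map a (iota m k) = nseq k b.
Proof.
elim: k m => //= k IH m ab; rewrite ab ?IH // => [i im|]; last by lia.
by apply: ab; lia.
Qed.

Section Computability.
Variable T : nat -> nat -> nat.
Local Notation stage_set := (stage_set T).
Local Notation action := (action T).

(** A stage lies below [block s], so this single number determines it and the stages can be produced
    by primitive recursion. *)
Definition stage_code s := prefix_code (stage_set s) (block s).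

(** Changes the length of the coded string from [block s] to [x]. By truncated subtraction at least
    one of the two powers is 1: zeros are appended if [x] exceeds [block s], otherwise last bits are
    removed. *)
Definition cut_code s c x := c * 2 ^ (x - block s) %/ 2 ^ (block s - x).

Lemma cut_stage_code s : cut_code s (stage_code s) = prefix_code (stage_set s).
Proof.
apply/funext => x; rewrite /cut_code /stage_code /prefix_code.
have [xs|/ltnW sx] := leqP x (block s).
  rewrite (eqP xs) muln1 -{1}(subnKC xs) /mkseq iotaD map_cat.
  by rewrite -[in 2 ^ _](size_iota (0 + x) (block s - x))
             -(size_map (stage_set s)) code_str_cat_div.
rewrite (eqP sx) divn1 -code_str_cat_false -[in RHS](subnKC sx) /mkseq iotaD map_cat.
congr (code_str (_ ++ _)); apply/esym/map_iota_nseq => m /andP[sm _].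
by apply/negbTE/negP => /stage_set_bound; rewrite ltnNge sm.
Qed.

Lemma action_bound s : action s <= block s.+1.
Proof.
rewrite /action /least_request; case: ifP => // /ltnW/leq_trans; apply.
by rewrite leq_block.
Qed.

(** Below the action the set is kept, and from there up to [block s.+1] ones are appended. With the
    default action only the zeros of [cut_code] are appended. *)
Lemma stage_codeS s :
  stage_code s.+1 =
  ((cut_code s (stage_code s) (action s)).+1 * 2 ^ (block s.+1 - action s)).-1.
Proof.
rewrite cut_stage_code -code_str_cat_true /stage_code /prefix_code.
rewrite -{1}(subnKC (action_bound s)) /mkseq iotaD map_cat.
congr (code_str (_ ++ _)).
  apply/eq_in_map => m; rewrite mem_iota add0n => /andP[_ ma].
  by rewrite stage_setS (leqNgt _ m) ma orbF.
apply: map_iota_nseq => m; rewrite add0n (subnKC (action_bound s)) => am.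
by rewrite stage_setS am orbT.
Qed.

(** This is [requests] with the set given by its prefix codes [P], so that only arithmetic
    occurs. *)
Definition requests_code s (P : nat -> nat) x :=
  has (fun j => [&& block j <= x, x < block j.+1, ~~ odd (P x.+1),
         all (fun y => (x < y) ==> odd (P y.+1)) (iota 0 (block j.+1))
       & all (fun n => (block j <= n) ==> described T s (P n) n j)
             (iota 0 (block j.+1))])
      (iota 0 s).

Lemma requests_codeE s a : requests_code s (prefix_code a) = requests T s a.
Proof.
apply/funext => x; apply: eq_has => j; rewrite odd_prefix_code.
by congr [&& _, _, _, _ & _]; apply: eq_all => y; rewrite odd_prefix_code.
Qed.

Definition action_code s c :=
  let x := find (requests_code s (cut_code s c)) (iota 0 (block s)) in
  if x < block s then x else block s.+1.

Lemma action_codeE s : action_code s (stage_code s) = action s.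
Proof. by rewrite /action_code cut_stage_code requests_codeE. Qed.

Lemma stage_code_rect s :
  nat_rect (fun=> nat) (stage_code 0)
    (fun k c => ((cut_code k c (action_code k c)).+1
                 * 2 ^ (block k.+1 - action_code k c)).-1) s = stage_code s.
Proof. by elim: s => //= s ->; rewrite stage_codeS action_codeE. Qed.

Hypothesis T_rec : total_rec 2 (fun w => T (head 0 w) (head 0 (behead w))).

Lemma total_rec_block n J : total_rec n J -> total_rec n (fun v => block (J v)).
Proof.
by move=> Jr; apply: total_rec_exp; [|apply: total_rec_exp]; total_rec_leaf.
Qed.

Lemma total_rec_cut_code n S C X :
  total_rec n S -> total_rec n C -> total_rec n X ->
  total_rec n (fun v => cut_code (S v) (C v) (X v)).
Proof.
move=> Sr Cr Xr; have Br := total_rec_block Sr.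
apply: total_rec_div; last first.
  apply: total_rec_exp; first by total_rec_leaf.
  exact: total_rec_sub.
apply: total_rec_mul => //; apply: total_rec_exp; first by total_rec_leaf.
exact: total_rec_sub.
Qed.

(* Dispatch on the head symbol: plain backtracking would unfold [block]. *)
Ltac total_rec_step :=
  lazymatch goal with
  | |- total_rec _ (fun _ => ?k) => exact: total_rec_cst
  | |- total_rec _ (fun v => nat_of_bool (@?P v && @?Q v)) =>
      apply: (@total_rec_and _ P Q)
  | |- total_rec _ (fun v => nat_of_bool (@?P v ==> @?Q v)) =>
      apply: (@total_rec_imp _ P Q)
  | |- total_rec _ (fun v => nat_of_bool (~~ @?P v)) =>
      apply: (@total_rec_neg _ P)
  | |- total_rec _ (fun v => nat_of_bool (@?F v <= @?G v)) =>
      apply: (@total_rec_leq _ F G)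
  | |- total_rec _ (fun v => nat_of_bool (@?F v == @?G v)) =>
      apply: (@total_rec_eq _ F G)
  | |- total_rec _ (fun v => nat_of_bool (odd (@?F v))) =>
      apply: (@total_rec_odd _ F)
  | |- total_rec _ (fun v => nat_of_bool (has (@?P v) (iota 0 (@?K v)))) =>
      refine (@total_rec_has _ (fun i v => P v i) K _ _); cbv beta
  | |- total_rec _ (fun v => nat_of_bool (all (@?P v) (iota 0 (@?K v)))) =>
      refine (@total_rec_all _ (fun i v => P v i) K _ _); cbv beta
  | |- total_rec _ (fun v => block (@?F v)) => apply: (@total_rec_block _ F)
  | |- total_rec _ (fun v => cut_code (@?S v) (@?C v) (@?X v)) =>
      apply: (@total_rec_cut_code _ S C X)
  | |- total_rec _ (fun v => T (@?S v) (@?P v)) =>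
      apply: (@total_rec_app2 T _ S P T_rec)
  | |- total_rec _ (fun v => (@?F v * @?G v)%N) => apply: (@total_rec_mul _ F G)
  | |- total_rec _ (fun v => (@?F v ^ @?G v)%N) => apply: (@total_rec_exp _ F G)
  | |- total_rec _ (fun v => (@?F v - @?G v)%N) => apply: (@total_rec_sub _ F G)
  | |- total_rec _ (fun v => (@?F v).+1) => apply: (@total_rec_succ _ F)
  | |- total_rec _ (fun v => (@?F v).-1) => apply: (@total_rec_pred _ F)
  end.

Ltac total_rec_auto := repeat first [total_rec_leaf | total_rec_step].

Lemma total_rec_described n S W N J :
  total_rec n S -> total_rec n W -> total_rec n N -> total_rec n J ->
  total_rec n (fun v => described T (S v) (W v) (N v) (J v)).
Proof. by move=> Sr Wr Nr Jr; rewrite /described; total_rec_auto. Qed.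

Lemma total_rec_requests_code n S C X :
  total_rec n S -> total_rec n C -> total_rec n X ->
  total_rec n (fun v => requests_code (S v) (cut_code (S v) (C v)) (X v)).
Proof.
move=> Sr Cr Xr; rewrite /requests_code.
by total_rec_auto; apply: total_rec_described; total_rec_auto.
Qed.

Lemma total_rec_action_code n S C :
  total_rec n S -> total_rec n C ->
  total_rec n (fun v => action_code (S v) (C v)).
Proof.
move=> Sr Cr; rewrite /action_code.
have fr : total_rec n (fun v => find (requests_code (S v) (cut_code (S v) (C v)))
                                     (iota 0 (block (S v)))).
  apply: (total_rec_find (P := fun x v => requests_code (S v) (cut_code (S v) (C v)) x)).
    by apply: total_rec_requests_code; total_rec_leaf.
  exact: total_rec_block.
by apply: total_rec_if; total_rec_auto.
Qed.

Lemma total_rec_stage_code n S :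
  total_rec n S -> total_rec n (fun v => stage_code (S v)).
Proof.
move=> Sr; apply: total_rec_ext (total_rec_prim _ _ Sr).
- by move=> v _; exact: stage_code_rect.
- exact: total_rec_cst.
- have ar : total_rec n.+2 (fun w => action_code (head 0 w) (head 0 (behead w))).
    by apply: total_rec_action_code; total_rec_leaf.
  by total_rec_auto.
Qed.

Lemma total_rec_stage_set n S M :
  total_rec n S -> total_rec n M -> total_rec n (fun v => stage_set (S v) (M v)).
Proof.
move=> Sr Mr; have cr := total_rec_stage_code Sr.
apply: total_rec_ext (_ : total_rec n
  (fun v => odd (cut_code (S v) (stage_code (S v)) (M v).+1))).
  by move=> v _; rewrite cut_stage_code odd_prefix_code.
by total_rec_auto.
Qed.

Lemma limit_set_ce : computably_enumerable (limit_set T).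
Proof.
apply: (total_rec_ce (P := stage_set)) => //.
by apply: total_rec_stage_set; total_rec_leaf.
Qed.

End Computability.

(** * Regaining approximability *)

Local Open Scope ring_scope.

Lemma infinite_nat_unbounded (A : set nat) :
  infinite_set A <-> forall N, exists2 n, (N <= n)%N & A n.
Proof.
split=> [Ainf N|unb /finite_seqP[l Al]].
  apply: contrapT => nex; apply: Ainf; apply: sub_finite_set (finite_II N).
  move=> n An /=; rewrite ltnNge; apply/negP => Nn.
  by apply: nex; exists n.
have [n ln An] := unb (\max_(i <- l) i).+1.
have : n \in l by move: An; rewrite Al.
by move=> nl; move: ln; rewrite ltnNge (@leq_bigmax_seq _ l xpredT id n).
Qed.

(** The leading 1 of the code contributes [2 ^+ n], the remaining bits the scaled partial sum. *)
Lemma prefix_code_sum (F : numFieldType) a n :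
  (prefix_code a n)%:R
  = 2 ^+ n * (1 + \sum_(0 <= m < n | a m) 2 ^- m.+1) :> F.
Proof.
elim: n => [|n IH]; first by rewrite big_geq // addr0 mulr1.
rewrite /prefix_code mkseqS code_str_rcons -mul2n natrD natrM.
rewrite -/(prefix_code a n) IH [in RHS]big_mkcond big_nat_recr //= -big_mkcond /=.
have n0 : 2 ^+ n.+1 != 0 :> F by rewrite expf_neq0 ?pnatr_eq0.
rewrite addrA [RHS]mulrDr exprS -!mulrA; congr (_ + _).
by case: (a n); rewrite ?mulr0 // mulrA -exprS divff.
Qed.

Lemma sum_pow2_tail (F : numFieldType) k n : (k <= n)%N ->
  \sum_(k <= m < n) 2 ^- m.+1 = 2 ^- k - 2 ^- n :> F.
Proof.
move=> kn; rewrite -opprB -(telescope_sumr (fun m => 2 ^- m) kn) -sumrN.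
apply: eq_bigr => m _; rewrite exprS invfM opprB.
have : 2 ^+ m != 0 :> F by rewrite expf_neq0 ?pnatr_eq0.
by move: (2 ^+ m) => x x0; field.
Qed.

Section Regaining.
Variables (R : realType) (T : nat -> nat -> nat).
Local Notation A := (limit_set T).

Definition partial_sum (P : pred nat) n : R := \sum_(0 <= m < n | P m) 2 ^- m.+1.

Lemma partial_sum_le (P Q : pred nat) m n : (m <= n)%N ->
  (forall i, (i < m)%N -> P i -> Q i) -> partial_sum P m <= partial_sum Q n.
Proof.
move=> mn PQ; rewrite /partial_sum [leRHS](big_cat_nat _ mn) //=.
apply: ler_wpDr; first by rewrite sumr_ge0 // => i _; rewrite invr_ge0 exprn_ge0.
rewrite [leLHS]big_mkcond [leRHS]big_mkcond !big_nat; apply: ler_sum => i.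
move=> /andP[_ im]; case Pi: (P i); first by rewrite (PQ i).
by case: (Q i) => //; rewrite invr_ge0 exprn_ge0.
Qed.

Lemma partial_sum_tail P k n : (k <= n)%N ->
  partial_sum P n <= partial_sum P k + 2 ^- k.
Proof.
move=> kn; rewrite /partial_sum [leLHS](big_cat_nat _ kn) //= lerD2l.
apply: (@le_trans _ _ (\sum_(k <= m < n) 2 ^- m.+1)).
  rewrite big_mkcond; apply: ler_sum => i _.
  by case: (P i) => //; rewrite invr_ge0 exprn_ge0.
by rewrite sum_pow2_tail // gerBl invr_ge0 exprn_ge0.
Qed.

Lemma partial_sum_cvg P : cvgn (partial_sum P).
Proof.
apply: nondecreasing_is_cvgn.
  by move=> m n mn; apply: partial_sum_le.
exists (partial_sum P 0 + 2 ^- 0) => _ [n _ <-].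
exact: partial_sum_tail.
Qed.

Lemma partial_sum_le_lim P n : partial_sum P n <= limn (partial_sum P).
Proof.
apply: nondecreasing_cvgn_le; last exact: partial_sum_cvg.
by move=> i j ij; apply: partial_sum_le.
Qed.

(** Subtracting [2 ^ block s] removes the leading 1 of the code. *)
Definition stage_sum s : rat :=
  (stage_code T s - 2 ^ block s)%:R / (2 ^ block s)%:R.

Lemma ratr_stage_sum s :
  ratr (stage_sum s) = partial_sum (stage_set T s) (block s).
Proof.
rewrite /stage_sum fmorph_div /= !ratr_nat natrB.
rewrite prefix_code_sum natrX mulrDr mulr1 addrAC subrr add0r mulrAC divff ?mul1r //.
by have /andP[] := code_str_bounds (mkseq (stage_set T s) (block s)); rewrite size_mkseq.
Qed.

Lemma stage_sum_le_lim s :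
  ratr (stage_sum s) <= limn (partial_sum (fun m => m \in A)).
Proof.
rewrite ratr_stage_sum; apply: le_trans (partial_sum_le_lim _ (block s)).
by apply: partial_sum_le => // m _ ms; rewrite in_setE; exists s.
Qed.

Lemma stage_sum_mono s t : (s <= t)%N -> ratr (stage_sum s) <= ratr (stage_sum t) :> R.
Proof.
move=> st; rewrite !ratr_stage_sum; apply: partial_sum_le.
  by rewrite leq_block.
by move=> m _; apply: stage_set_mono.
Qed.

(** After a stable stage only elements from [block s] on can enter, and together they weigh at most
    [2 ^- block s]. *)
Lemma stable_stage_sum s : stable T s ->
  limn (partial_sum (fun m => m \in A)) <= ratr (stage_sum s) + 2 ^- block s.
Proof.
move=> ss; apply: limr_le; first exact: partial_sum_cvg.
near=> n; have bn : (block s <= n)%N by near: n; exact: nbhs_infty_ge.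
apply: le_trans (partial_sum_tail _ bn) _; rewrite lerD2r ratr_stage_sum.
apply: partial_sum_le => // m ms; rewrite (limit_setE (s := s)) // => t st.
exact: stable_stage_set.
Unshelve. all: by end_near.
Qed.

Lemma limit_set_regaining :
  total_rec 2 (fun w => T (head 0%N w) (head 0%N (behead w))) ->
  regainingly_approximable_set R A.
Proof.
move=> Tr; split; first exact: limit_set_ce.
(* The inequality becomes strict because [s < block s]. *)
have sub s : stable T s ->
    limn (partial_sum (fun m => m \in A)) - ratr (stage_sum s) < 2 ^- s.
  move=> /stable_stage_sum; rewrite -lerBlDl => /le_lt_trans; apply.
  by rewrite ltf_pV2 ?posrE ?exprn_gt0 // ltr_eXn2l ?ltr1n // ltn_id_block.
exists stage_sum; split.
- exists (fun=> 0%N), (fun s => stage_code T s - 2 ^ block s)%N,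
         (fun s => 2 ^ block s)%N.
  have br : total_rec 1 (fun v => 2 ^ block (head 0 v))%N.
    apply: total_rec_exp; first exact: total_rec_cst.
    exact/total_rec_block/total_rec_head.
  split; try apply: total_rec_computable => //; first exact: total_rec_cst.
    apply: total_rec_sub => //; apply: total_rec_stage_code => //.
    exact: total_rec_head.
  by move=> n; split; [apply/eqP; rewrite expn_eq0 | rewrite expr0 mul1r].
- by move=> n; rewrite -(ler_rat R) stage_sum_mono.
- rewrite /two_pow_opp -/(partial_sum (fun m => m \in A)).
  apply/cvgrPdist_le => e e0.
  have [k /ltW] := filter_ex (near_infty_natSinv_expn_lt (PosNum e0)).
  rewrite mul1r /= => ke.
  (* The sums increase and stay below the limit, so the error at one stable stage beyond [k] bounds
     all later errors. *)
  have [s ks ss] := exists_stable T k.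
  near=> n; have sn : (s <= n)%N by near: n; exact: nbhs_infty_ge.
  rewrite ger0_norm ?subr_ge0 ?stage_sum_le_lim //.
  apply: le_trans ke; apply: (@le_trans _ _ (2 ^- s)).
    apply: le_trans (ltW (sub _ ss)); rewrite lerD2l lerN2.
    exact: stage_sum_mono.
  by rewrite lef_pV2 ?posrE ?exprn_gt0 // ler_eXn2l ?ltr1n // ltnW.
- apply/infinite_nat_unbounded => N; have [s Ns ss] := exists_stable T N.
  by exists s; [exact: ltnW | exact: sub].
Unshelve. all: by end_near.
Qed.
End Regaining.

Local Close Scope ring_scope.

(** * Complexity *)

(** An optimal machine simulates the prefix-free machine whose only program is the empty string,
    with code 1, and whose output is [x]. *)
Lemma optimal_program U x : optimal_prefix_free_machine U -> exists p, run U p x.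
Proof.
move=> [_ Uopt].
have [M MP] : total_rec 1 (fun v => if head 0 v == 1 then code_str x else 0).
  apply: total_rec_if; [|exact: total_rec_cst|exact: total_rec_cst].
  by apply: total_rec_eq; [exact: total_rec_head | exact: total_rec_cst].
have runM p y : run M p y -> p = [::].
  move=> /rec_eval_fun/(_ (MP [tuple code_str p]))/=; case: eqP => [p1 _|_ y0].
    exact: (code_str_inj (x2 := [::])).
  by have := code_str_gt0 y; rewrite y0.
have [|c cP] := Uopt M; first by move=> p q y z /runM-> /runM->.
by have [|q Uq _] := cP [::] x; [exact: (MP [tuple 1]) | exists q].
Qed.

Lemma K_complexity_attained U x : optimal_prefix_free_machine U ->
  exists2 p, run U p x & size p = K_complexity U x.
Proof.
move=> Uo; have [p0 p0x] := optimal_program x Uo.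
pose P k := `[< exists2 p, run U p x & size p = k >].
have exP : exists k, P k by exists (size p0); apply/asboolP; exists p0.
case: (ex_minnP exP) => k /asboolP kx kmin.
rewrite /K_complexity; case: xgetP => [_ -> [] //|/(_ k)[]].
by split=> // p px; apply: kmin; apply/asboolP; exists p.
Qed.

(** With [k] the integer part of [log2 n], the exponent is at most [2 * k + s + 4]; the 4 gives the
    factor 16. *)
Lemma binlog_block s n : 0 < n -> n < block s.+1 ->
  2 ^ (2 * binlog n + binlog (binlog n)) <= n ^ 2 * 2 ^ s * 16.
Proof.
move=> n0 nb; rewrite /binlog; set k := trunc_log 2 n.
have kn : 2 ^ k <= n by apply: trunc_logP.
have ks : k < 2 ^ s.+1.
  by rewrite -(ltn_exp2l _ _ (isT : 1 < 2)); apply: leq_ltn_trans nb.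
have ls : trunc_log 2 k.+1 <= s.+1.
  by rewrite -(leq_exp2l _ _ (isT : 1 < 2)) (leq_trans _ ks) // trunc_logP.
apply: (@leq_trans (2 ^ (2 * k.+1 + s.+2))); first by rewrite leq_exp2l // leq_add2l.
have -> : 2 * k.+1 + s.+2 = k * 2 + s + 4 by lia.
by rewrite !expnD expnM !leq_mul // leq_exp2r.
Qed.

Theorem theorem7p4 (R : realType) :
  exists A : set nat,
    regainingly_approximable_set R A /\ Kummer_K_complex A.
Proof.
(* The set is chosen before [U], so one machine [U0] has to serve for all [U]. If no optimal machine
   exists, the complexity claim is vacuous and [RSucc] is a dummy. *)
have [U0 U0o] : exists U0, forall U, optimal_prefix_free_machine U ->
    optimal_prefix_free_machine U0.
  have [[U Uo]|noU] := pselect (exists U, optimal_prefix_free_machine U).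
    by exists U.
  by exists RSucc => U Uo; case: noU; exists U.
have [T0 [T0r T0m T0P]] := approximable U0.
pose T s p := T0 [:: s; p].
have Tr : total_rec 2 (fun w => T (head 0 w) (head 0 (behead w))).
  by apply: total_rec_ext T0r => -[|a [|b []]].
have Tm s t p y : s <= t -> T s p = y.+1 -> T t p = y.+1 by exact: T0m.
have TP p y : rec_eval U0 [tuple p] y <-> exists s, T s p = y.+1 by exact: T0P.
exists (limit_set T); split; first exact: limit_set_regaining.
move=> U Uo; have [U0pf U0opt] := U0o U Uo; have [c cP] := U0opt U Uo.1.
(* The factors 16 in [described] and in [binlog_block] cost 4 each; [c] is the cost of simulating
   [U] by [U0]. *)
exists (8 + c); apply/infinite_nat_unbounded => N.
have [s Ns ss] := exists_stable T N; have s0 : 0 < s by case: s Ns {ss}.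
have [n /andP[sn ns] nd] := stable_not_described Tm TP U0pf s0 ss.
have n0 : 0 < n by apply: leq_trans sn; rewrite expn_gt0.
exists n.
  by apply: ltnW; apply: ltn_trans Ns _; apply: leq_trans (ltn_id_block s) sn.
rewrite /= leqNgt; apply/negP => small.
(* A shortest [U]-program would translate into a [U0]-program [q] short enough for [described],
   against the choice of [n]. *)
have [p px pK] := K_complexity_attained (restriction (limit_set T) n) Uo.
have [q qx qp] := cP _ _ px; have /TP[t Tq] := qx.
have := nd t; apply/negP; rewrite negbK; apply/describedP.
exists (code_str q); split=> //; first exact: code_str_gt0.
have [/andP[_ qhi] nlog] := (code_str_bounds q, binlog_block n0 ns).
rewrite -(ltn_pmul2r (isT : 0 < 16)); apply: leq_trans nlog.
apply: (@leq_trans (2 ^ ((size q).+1 + 8))); last by rewrite leq_exp2l //; lia.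
by rewrite expnD -mulnA ltn_pmul2r.
Qed.
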